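(* Let $k$ be a field and let $(A,H,\triangleright,\triangleleft)$ be a matched pair of Hopf algebras over $k$ with $H$ cocommutative. Then the tensor product coalgebra $A\otimes H$ with the two algebra structures $$(a\otimes x)(b\otimes y) = a(x_{(1)}\triangleright b_{(1)})\otimes (x_{(2)}\triangleleft b_{(2)})\,y,$$ $$(a\otimes x)\circ(b\otimes y) = ab\otimes yx$$ ($a,b\in A$, $x,y\in H$) is a Hopf brace.
   Context: All vector spaces, tensor products, algebras, coalgebras and Hopf algebras are over the field $k$. Sweedler notation $\Delta(c)=c_{(1)}\otimes c_{(2)}$ is used with summation suppressed. Hopf brace: a Hopf brace over a coalgebra $(H,\Delta,\varepsilon)$ consists of two Hopf algebra structures $(H,\cdot,1,\Delta,\varepsilon,S)$ and $(H,\circ,1_\circ,\Delta,\varepsilon,T)$ on the same coalgebra such that for all $x,y,z\in H$ $$x\circ(yz) = (x_{(1)}\circ y)\,S(x_{(2)})\,(x_{(3)}\circ z),$$ where juxtaposition denotes the product $\cdot$ (it follows that $1=1_\circ$). In a pair of algebra structures on a coalgebra said to be a Hopf brace, the one written by juxtaposition plays the role of $\cdot$ and the other that of $\circ$. Matched pair: for Hopf algebras $A$, $H$, a matched pair consists of coalgebra maps $\triangleleft : H\otimes A\to H$ and $\triangleright : H\otimes A\to A$ such that $(A,\triangleright)$ is a left $H$-module coalgebra, $(H,\triangleleft)$ is a right $A$-module coalgebra, and for all $a,b\in A$, $x,y\in H$: $x\triangleright 1_A=\varepsilon_H(x)1_A$ and $1_H\triangleleft a=\varepsilon_A(a)1_H$;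 $x\triangleright(ab)=(x_{(1)}\triangleright a_{(1)})\big((x_{(2)}\triangleleft a_{(2)})\triangleright b\big)$; $(xy)\triangleleft a=\big(x\triangleleft(y_{(1)}\triangleright a_{(1)})\big)(y_{(2)}\triangleleft a_{(2)})$; $x_{(1)}\triangleleft a_{(1)}\otimes x_{(2)}\triangleright a_{(2)}=x_{(2)}\triangleleft a_{(2)}\otimes x_{(1)}\triangleright a_{(1)}$. *)

(* Defs.v *)
From HB Require Import structures.
From mathcomp Require Import all_boot all_order all_algebra.
From mathcomp Require Import boolp.

Set Implicit Arguments.
Unset Strict Implicit.
Unset Printing Implicit Defensive.
Import GRing.Theory.
Local Open Scope ring_scope.
Local Open Scope quotient_scope.

(* The tensor product of two vector spaces: finite formal sums of pairs (u, v),
   modulo the congruence generated by the bilinearity relations. *)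

Inductive tens_rel (k : fieldType) (U V : lmodType k) :
    seq (U * V) -> seq (U * V) -> Prop :=
| tens_refl s : tens_rel s s
| tens_sym s t : tens_rel s t -> tens_rel t s
| tens_trans s t r : tens_rel s t -> tens_rel t r -> tens_rel s r
| tens_cat s s' t t' :
    tens_rel s s' -> tens_rel t t' -> tens_rel (s ++ t) (s' ++ t')
| tens_comm s t : tens_rel (s ++ t) (t ++ s)
| tens_zero v : tens_rel [:: (0, v)] [::]
| tens_addl u u' v : tens_rel [:: (u + u', v)] [:: (u, v); (u', v)]
| tens_addr u v v' : tens_rel [:: (u, v + v')] [:: (u, v); (u, v')]
| tens_scale a u v : tens_rel [:: (a *: u, v)] [:: (u, a *: v)].

Section Tensor.
Variables (k : fieldType) (U V : lmodType k).
Implicit Types (s t : seq (U * V)).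

Definition tens_eqb : rel (seq (U * V)) := fun s t => `[< tens_rel s t >].

Lemma tens_eqb_refl : reflexive tens_eqb.
Proof. by move=> s; apply/asboolP; apply: tens_refl. Qed.

Lemma tens_eqb_sym : symmetric tens_eqb.
Proof.
by move=> s t; apply/asboolP/asboolP => h; apply: tens_sym.
Qed.

Lemma tens_eqb_trans : transitive tens_eqb.
Proof.
move=> t s r /asboolP st /asboolP tr; apply/asboolP; exact: tens_trans st tr.
Qed.

Canonical tens_equiv := EquivRel tens_eqb tens_eqb_refl tens_eqb_sym
  tens_eqb_trans.

Definition tensor : Type := {eq_quot tens_equiv}.
HB.instance Definition _ := Choice.on tensor.
HB.instance Definition _ : EqQuotient (seq (U * V)) tens_equiv tensor :=
  EqQuotient.on tensor.

Definition tens_class : seq (U * V) -> tensor := \pi_tensor.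

Lemma tens_reprK : cancel repr tens_class.
Proof. exact: (@reprK _ tensor). Qed.

Lemma tens_piP s t : (tens_class s = tens_class t) <-> tens_rel s t.
Proof.
split=> [/eqP|st]; first by rewrite [_ == _]eqmodE => /asboolP.
by apply/eqP; rewrite [_ == _]eqmodE; apply/asboolP.
Qed.

Lemma tens_repr s : tens_rel (repr (tens_class s)) s.
Proof. by apply/tens_piP; rewrite tens_reprK. Qed.

Definition seq_opp s : seq (U * V) := [seq (- p.1, p.2) | p <- s].
Definition seq_scale (a : k) s : seq (U * V) := [seq (a *: p.1, p.2) | p <- s].

Lemma seq_scaleP a s t :
  tens_rel s t -> tens_rel (seq_scale a s) (seq_scale a t).
Proof.
elim=> {s t} [s|s t _|s t r _ h _|s s' t t' _ hs _ ht|s t|v|u u' v|u v v'|b u v].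
- exact: tens_refl.
- exact: tens_sym.
- exact: tens_trans h.
- by rewrite /seq_scale !map_cat; apply: tens_cat.
- by rewrite /seq_scale !map_cat; apply: tens_comm.
- by rewrite /seq_scale /= scaler0; apply: tens_zero.
- by rewrite /seq_scale /= scalerDr; apply: tens_addl.
- exact: tens_addr.
- by rewrite /seq_scale /= scalerA mulrC -scalerA; apply: tens_scale.
Qed.

Lemma seq_oppE s : seq_opp s = seq_scale (-1) s.
Proof. by apply: eq_map => p; rewrite scaleN1r. Qed.

Definition tens0 : tensor := tens_class [::].
Definition tensD (x y : tensor) : tensor := tens_class (repr x ++ repr y).
Definition tensN (x : tensor) : tensor := tens_class (seq_opp (repr x)).
Definition tensZ (a : k) (x : tensor) : tensor := tens_class (seq_scale a (repr x)).

Lemma tensD_pi s t : tensD (tens_class s) (tens_class t) = tens_class (s ++ t).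
Proof. by apply/tens_piP; apply: tens_cat; apply: tens_repr. Qed.

Lemma tensN_pi s : tensN (tens_class s) = tens_class (seq_opp s).
Proof.
by apply/tens_piP; rewrite !seq_oppE; apply: seq_scaleP; apply: tens_repr.
Qed.

Lemma tensZ_pi a s : tensZ a (tens_class s) = tens_class (seq_scale a s).
Proof. by apply/tens_piP; apply: seq_scaleP; apply: tens_repr. Qed.

Lemma tens_ind_pi (P : tensor -> Prop) : (forall s, P (tens_class s)) -> forall x, P x.
Proof. by move=> h x; rewrite -[x]tens_reprK; apply: h. Qed.

Lemma tensDA : associative tensD.
Proof.
elim/tens_ind_pi=> s; elim/tens_ind_pi=> t; elim/tens_ind_pi=> r.
by rewrite !tensD_pi catA.
Qed.

Lemma tensDC : commutative tensD.
Proof.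
elim/tens_ind_pi=> s; elim/tens_ind_pi=> t.
by rewrite !tensD_pi; apply/tens_piP; apply: tens_comm.
Qed.

Lemma tens0D : left_id tens0 tensD.
Proof. by elim/tens_ind_pi=> s; rewrite tensD_pi. Qed.

Lemma tensNr : left_inverse tens0 tensN tensD.
Proof.
elim/tens_ind_pi=> s; rewrite tensN_pi tensD_pi; apply/tens_piP.
elim: s => [|[u v] s ih] /=; first exact: tens_refl.
have h1 : tens_rel ((- u, v) :: seq_opp s ++ (u, v) :: s)
    ([:: (- u, v); (u, v)] ++ (seq_opp s ++ s)).
  rewrite -[(- u, v) :: _]/([:: (- u, v)] ++ _).
  rewrite -[[:: (- u, v); (u, v)] ++ _]/([:: (- u, v)] ++ _).
  apply: tens_cat; first exact: tens_refl.
  rewrite -[(u, v) :: s]/([:: (u, v)] ++ s) catA -[_ :: _ ++ s]/(([:: (u, v)] ++ seq_opp s) ++ s).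
  by apply: tens_cat; [apply: tens_comm|apply: tens_refl].
apply: tens_trans h1 _.
rewrite -[[::] in X in tens_rel _ X]/([::] ++ [::]).
apply: tens_cat ih.
apply: tens_trans (tens_sym (tens_addl _ _ _)) _.
by rewrite addNr; apply: tens_zero.
Qed.

HB.instance Definition _ :=
  GRing.isZmodule.Build tensor tensDA tensDC tens0D tensNr.

Lemma tensZA a b x : tensZ a (tensZ b x) = tensZ (a * b) x.
Proof.
elim/tens_ind_pi: x => s; rewrite !tensZ_pi /seq_scale -map_comp.
by congr (tens_class _); apply: eq_map => p /=; rewrite scalerA.
Qed.

Lemma tens1Z : left_id 1 tensZ.
Proof.
elim/tens_ind_pi=> s; rewrite tensZ_pi; congr (tens_class _).
by rewrite -[RHS]map_id; apply: eq_map => -[u v] /=; rewrite scale1r.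
Qed.

Lemma tensZDr : right_distributive tensZ +%R.
Proof.
move=> a; elim/tens_ind_pi=> s; elim/tens_ind_pi=> t.
by rewrite /+%R /= tensD_pi !tensZ_pi tensD_pi /seq_scale map_cat.
Qed.

Lemma tensZDl x : {morph tensZ^~ x : a b / a + b}.
Proof.
move=> a b; elim/tens_ind_pi: x => s.
rewrite [RHS]/+%R /= !tensZ_pi tensD_pi; apply/tens_piP.
elim: s => [|[u v] s ih] /=; first exact: tens_refl.
rewrite -[_ :: _ ++ _]/(((a *: u, v) :: seq_scale a s) ++ _).
rewrite -[X in tens_rel X _]/([:: ((a + b) *: u, v)] ++ seq_scale (a + b) s).
apply: tens_trans (tens_cat _ ih) _.
  by rewrite scalerDl; apply: tens_addl.
rewrite -[[:: _; _] ++ _]/([:: (a *: u, v)] ++ ([:: (b *: u, v)] ++ _)).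
rewrite -[X in tens_rel _ X]/
  ([:: (a *: u, v)] ++ (seq_scale a s ++ ([:: (b *: u, v)] ++ seq_scale b s))).
apply: tens_cat; first exact: tens_refl.
rewrite !catA; apply: tens_cat; last exact: tens_refl.
exact: tens_comm.
Qed.

HB.instance Definition _ :=
  GRing.Zmodule_isLmodule.Build k tensor tensZA tens1Z tensZDr tensZDl.

Lemma tens_classD s t : tens_class s + tens_class t = tens_class (s ++ t).
Proof. exact: tensD_pi. Qed.

Lemma tens_classZ a s : a *: tens_class s = tens_class (seq_scale a s).
Proof. exact: tensZ_pi. Qed.

Definition pure (u : U) (v : V) : tensor := tens_class [:: (u, v)].

(* For bilinear f, [tsum f] is the linear map U (x) V -> W sending u (x) v to
   f u v: see [tsum_pure] and [tsum_linear].  The chosen representative of t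
   matters only when f is not bilinear. *)
Definition tsum (W : nmodType) (f : U -> V -> W) (t : tensor) : W :=
  \sum_(p <- repr t) f p.1 p.2.

End Tensor.

Arguments pure {k U V}.
Notation "u \ot v" := (pure u v)
  (at level 40, left associativity, format "u  \ot  v") : ring_scope.

(* With t := D x for a comultiplication D this is Sweedler notation. *)
Notation "\tsum_ ( u , v <- t ) F" := (tsum (fun u v => F) t)
  (at level 41, F at level 41, u name, v name, t at level 50,
   format "'[' \tsum_ ( u ,  v  <-  t ) '/  '  F ']'") : ring_scope.

Section TensorTheory.
Variables (k : fieldType) (U V : lmodType k).

Definition is_bilinear (W : lmodType k) (f : U -> V -> W) : Prop :=
  (forall v, linear (f^~ v)) /\ (forall u, linear (f u)).

Lemma pure_bilinear : is_bilinear (@pure k U V).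
Proof.
split=> [v a u u'|u a v v'].
  rewrite /pure tens_classZ tens_classD.
  by apply/tens_piP; apply: tens_addl.
rewrite /pure tens_classZ tens_classD.
apply/tens_piP; apply: tens_trans (tens_addr _ _ _) _.
rewrite -[[:: _; _]]/([:: (u, a *: v)] ++ [:: (u, v')]).
by apply: tens_cat; [apply: tens_sym; apply: tens_scale|apply: tens_refl].
Qed.

Lemma tensor_pure (t : tensor U V) : t = \sum_(p <- repr t) p.1 \ot p.2.
Proof.
rewrite -[LHS]tens_reprK; elim: (repr t) => [|[u v] s ih]; first by rewrite big_nil.
by rewrite big_cons -ih /pure tens_classD.
Qed.

Section Lift.
Variables (W : lmodType k) (f : U -> V -> W).
Hypothesis fP : is_bilinear f.

Lemma tens_rel_sum s t : tens_rel s t ->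
  \sum_(p <- s) f p.1 p.2 = \sum_(p <- t) f p.1 p.2.
Proof.
case: fP => fl fr.
have f0 v : f 0 v = 0.
  by have := fl v (-1) 0 0; rewrite scaler0 addr0 scaleN1r addNr.
have f0r u : f u 0 = 0.
  by have := fr u (-1) 0 0; rewrite scaler0 addr0 scaleN1r addNr.
elim=> {s t} [s|s t _|s t r _ h _|s s' t t' _ hs _ ht|s t|v|u u' v|u v v'|b u v].
- by [].
- by [].
- by rewrite h.
- by rewrite !big_cat hs ht.
- by rewrite !big_cat /= addrC.
- by rewrite big_seq1 big_nil.
- rewrite big_seq1 big_cons big_seq1 /=.
  by have := fl v 1 u u'; rewrite !scale1r.
- rewrite big_seq1 big_cons big_seq1 /=.
  by have := fr u 1 v v'; rewrite !scale1r.
- rewrite !big_seq1 /=.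
  have := fl v b u 0; have := fr u b v 0.
  by rewrite !addr0 f0 f0r !addr0 => -> ->.
Qed.

Lemma tsum_pi s : tsum f (tens_class s) = \sum_(p <- s) f p.1 p.2.
Proof. by apply: tens_rel_sum; apply: tens_repr. Qed.

Lemma tsum_pure u v : tsum f (u \ot v) = f u v.
Proof. by rewrite tsum_pi big_seq1. Qed.

Lemma tsum_linear : linear (tsum f).
Proof.
move=> a; elim/tens_ind_pi=> s; elim/tens_ind_pi=> t.
rewrite tens_classZ tens_classD.
rewrite !tsum_pi big_cat big_map scaler_sumr; congr (_ + _).
apply: eq_bigr => -[u v] _ /=; case: fP => fl fr.
have f0 : f 0 v = 0.
  by have := fl v (-1) 0 0; rewrite scaler0 addr0 scaleN1r addNr.
by have := fl v a u 0; rewrite addr0 f0 addr0.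
Qed.

End Lift.

Lemma tensor_ext (W : lmodType k) (g h : tensor U V -> W) :
  linear g -> linear h -> (forall u v, g (u \ot v) = h (u \ot v)) -> g =1 h.
Proof.
move=> gl hl gh t; rewrite (tensor_pure t).
have g0 : g 0 = 0.
  by have := gl (-1) 0 0; rewrite scaler0 addr0 scaleN1r addNr.
have h0 : h 0 = 0.
  by have := hl (-1) 0 0; rewrite scaler0 addr0 scaleN1r addNr.
elim: (repr t) => [|p s ih]; first by rewrite big_nil g0 h0.
rewrite big_cons; have := gl 1 (p.1 \ot p.2) (\sum_(q <- s) q.1 \ot q.2).
by rewrite !scale1r gh ih => ->; have := hl 1 (p.1 \ot p.2) (\sum_(q <- s) q.1 \ot q.2);
   rewrite !scale1r => ->.
Qed.

End TensorTheory.

Section Hopf.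
Variable k : fieldType.

Record is_algebra (C : lmodType k) (m : C -> C -> C) (e : C) : Prop :=
  IsAlgebra {
    alg_bilinear : is_bilinear m;
    alg_assoc : associative m;
    alg_unitl : left_id e m;
    alg_unitr : right_id e m }.

(* Coassociativity is an equality in C (x) (C (x) C); the associator is
   expressed by the bracketing of the tensors on the left. *)
Record is_coalgebra (C : lmodType k) (D : C -> tensor C C) (E : C -> k) : Prop :=
  IsCoalgebra {
    comul_linear : linear D;
    counit_scalar : scalar E;
    coassoc : forall x,
      \tsum_(x', x3 <- D x) \tsum_(x1, x2 <- D x') x1 \ot (x2 \ot x3)
      = \tsum_(x1, x'' <- D x) x1 \ot D x'';
    counitl : forall x, \tsum_(x1, x2 <- D x) E x1 *: x2 = x;
    counitr : forall x, \tsum_(x1, x2 <- D x) E x2 *: x1 = x }.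

Definition cocommutative (C : lmodType k) (D : C -> tensor C C) : Prop :=
  forall x, D x = \tsum_(x1, x2 <- D x) x2 \ot x1.

Definition tcomul (A H : lmodType k) (DA : A -> tensor A A)
    (DH : H -> tensor H H) (t : tensor A H) : tensor (tensor A H) (tensor A H) :=
  \tsum_(a, x <- t) \tsum_(a1, a2 <- DA a) \tsum_(x1, x2 <- DH x)
    (a1 \ot x1) \ot (a2 \ot x2).

Definition tcounit (A H : lmodType k) (EA : A -> k) (EH : H -> k)
    (t : tensor A H) : k :=
  \tsum_(a, x <- t) EA a * EH x.

Record is_coalgebra_map (C C' : lmodType k)
    (D : C -> tensor C C) (E : C -> k) (D' : C' -> tensor C' C') (E' : C' -> k)
    (f : C -> C') : Prop := IsCoalgebraMap {
  cmap_linear : linear f;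
  cmap_comul : forall x, D' (f x) = \tsum_(x1, x2 <- D x) f x1 \ot f x2;
  cmap_counit : forall x, E' (f x) = E x }.

Record is_hopf (C : lmodType k) (m : C -> C -> C) (e : C)
    (D : C -> tensor C C) (E : C -> k) (S : C -> C) : Prop := IsHopf {
  hopf_algebra : is_algebra m e;
  hopf_coalgebra : is_coalgebra D E;
  comul_unit : D e = e \ot e;
  comul_mul : forall x y, D (m x y) =
    \tsum_(x1, x2 <- D x) \tsum_(y1, y2 <- D y) m x1 y1 \ot m x2 y2;
  counit_unit : E e = 1;
  counit_mul : forall x y, E (m x y) = E x * E y;
  antipode_linear : linear S;
  antipodel : forall x, \tsum_(x1, x2 <- D x) m (S x1) x2 = E x *: e;
  antipoder : forall x, \tsum_(x1, x2 <- D x) m x1 (S x2) = E x *: e }.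

(* [m] is the product written by juxtaposition, [c] is the circle product. *)
Record is_hopf_brace_with (C : lmodType k) (D : C -> tensor C C) (E : C -> k)
    (m : C -> C -> C) (e : C) (S : C -> C)
    (c : C -> C -> C) (e' : C) (T : C -> C) : Prop := IsHopfBraceWith {
  brace_hopf : is_hopf m e D E S;
  brace_hopf_circ : is_hopf c e' D E T;
  brace_compat : forall x y z, c x (m y z) =
    \tsum_(x', x3 <- D x) \tsum_(x1, x2 <- D x')
      m (m (c x1 y) (S x2)) (c x3 z) }.

Definition is_hopf_brace (C : lmodType k) (D : C -> tensor C C) (E : C -> k)
    (m : C -> C -> C) (e : C) (c : C -> C -> C) (e' : C) : Prop :=
  exists S T : C -> C, is_hopf_brace_with D E m e S c e' T.

(* [lact x a] is x |> a and [ract x a] is x <| a; a map out of H (x) A is given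
   by the corresponding bilinear map, the linear map itself being its [tsum]. *)
Record is_matched_pair (A H : algType k)
    (DA : A -> tensor A A) (EA : A -> k) (DH : H -> tensor H H) (EH : H -> k)
    (lact : H -> A -> A) (ract : H -> A -> H) : Prop := IsMatchedPair {
  lact_bilinear : is_bilinear lact;
  ract_bilinear : is_bilinear ract;
  lact_cmap :
    is_coalgebra_map (tcomul DH DA) (tcounit EH EA) DA EA (tsum lact);
  ract_cmap :
    is_coalgebra_map (tcomul DH DA) (tcounit EH EA) DH EH (tsum ract);
  lact1 : forall a, lact 1 a = a;
  lactM : forall x y a, lact (x * y) a = lact x (lact y a);
  ract1 : forall x, ract x 1 = x;
  ractM : forall x a b, ract x (a * b) = ract (ract x a) b;
  lact_unit : forall x, lact x 1 = EH x *: 1;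
  ract_unit : forall a, ract 1 a = EA a *: 1;
  lact_mul : forall x a b, lact x (a * b) =
    \tsum_(x1, x2 <- DH x) \tsum_(a1, a2 <- DA a)
      lact x1 a1 * lact (ract x2 a2) b;
  ract_mul : forall x y a, ract (x * y) a =
    \tsum_(y1, y2 <- DH y) \tsum_(a1, a2 <- DA a)
      ract x (lact y1 a1) * ract y2 a2;
  lact_ract : forall x a,
    \tsum_(x1, x2 <- DH x) \tsum_(a1, a2 <- DA a) ract x1 a1 \ot lact x2 a2
    = \tsum_(x1, x2 <- DH x) \tsum_(a1, a2 <- DA a) ract x2 a2 \ot lact x1 a1 }.

Definition bicrossed_mul (A H : algType k)
    (DA : A -> tensor A A) (DH : H -> tensor H H)
    (lact : H -> A -> A) (ract : H -> A -> H) (s t : tensor A H) : tensor A H :=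
  \tsum_(a, x <- s) \tsum_(b, y <- t)
    \tsum_(x1, x2 <- DH x) \tsum_(b1, b2 <- DA b)
      (a * lact x1 b1) \ot (ract x2 b2 * y).

Definition tensor_op_mul (A H : algType k) (s t : tensor A H) : tensor A H :=
  \tsum_(a, x <- s) \tsum_(b, y <- t) (a * b) \ot (y * x).

End Hopf.

(* Main.v *)
(* A (x) H^op is a Hopf algebra for the circle product because cocommutativity
   makes the antipode of H one for H^op as well.  In the bicrossed product
   a (x) x = (a (x) 1)(1 (x) x), and a (x) x |-> (1 (x) S x)(S a (x) 1) is an
   antipode.  With these factorizations the right-hand side of the brace
   compatibility telescopes:
     (a1 b (x) y h1)(1 (x) S h2)(S a2 (x) 1)(a3 c (x) z h3)
       = (a b (x) y)(c (x) z h),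
   which is also (a (x) h) o ((b (x) y)(c (x) z)). *)

Require Import Defs.
From HB Require Import structures.
From mathcomp Require Import all_boot all_order all_algebra ring.
Import GRing.Theory.
Local Open Scope ring_scope.

Set Implicit Arguments.
Unset Strict Implicit.
Unset Printing Implicit Defensive.

(** * Linearity and exchange rules for [tsum] *)

Section TsumCalculus.
Variable k : fieldType.
Implicit Types U V W X Y : lmodType k.

(* [linear] is a [forall] over arbitrary structures; fixing both carriers as
   [lmodType k] lets the tactic [lin] below match on them. *)
Definition islin U W (f : U -> W) : Prop := linear f.

Lemma lin_id U : islin (fun u : U => u).
Proof. by []. Qed.

Lemma lin_comp U V W (g : V -> W) (f : U -> V) :
  islin g -> islin f -> islin (fun u => g (f u)).
Proof. by move=> gl fl a u v; rewrite fl gl. Qed.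

Lemma lin_scalar U V W (g : V -> k) (f : U -> V) (w : W) :
  scalar g -> islin f -> islin (fun u => g (f u) *: w).
Proof. by move=> gl fl a u v; rewrite fl gl scalerDl scalerA. Qed.

Lemma lin_scale U W (c : k) (f : U -> W) :
  islin f -> islin (fun u => c *: f u).
Proof. by move=> fl a u v; rewrite fl scalerDr !scalerA mulrC. Qed.

Lemma lin0 U W (g : U -> W) : islin g -> g 0 = 0.
Proof. by move=> gl; have := gl (-1) 0 0; rewrite scaler0 addr0 scaleN1r addNr. Qed.

Lemma linZ U W (g : U -> W) a u : islin g -> g (a *: u) = a *: g u.
Proof. by move=> gl; have := gl a u 0; rewrite (lin0 gl) !addr0. Qed.

Lemma lin_sum U W (g : U -> W) I (r : seq I) (F : I -> U) :
  islin g -> g (\sum_(i <- r) F i) = \sum_(i <- r) g (F i).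
Proof.
move=> gl; elim: r => [|i r ih]; first by rewrite !big_nil lin0.
by rewrite !big_cons -ih; have := gl 1 (F i) (\sum_(j <- r) F j); rewrite !scale1r.
Qed.

(** The tensor [t] is fixed, hence so is its representative, and linearity in [x] passes through the
    finite sum term by term. *)
Lemma lin_tsumf U V X W (f : U -> V -> X -> W) (t : tensor U V) :
  (forall u v, islin (f u v)) -> islin (fun x => \tsum_(u, v <- t) f u v x).
Proof.
move=> fl a x y; rewrite /tsum scaler_sumr -big_split /=.
by apply: eq_bigr => p _; apply: fl.
Qed.

(** Here the tensor itself varies, and its chosen representative need not vary additively;
    bilinearity of [f] makes the value independent of that choice. *)
Lemma lin_tsumt U V X W (f : U -> V -> W) (g : X -> tensor U V) :
  is_bilinear f -> islin g -> islin (fun x => tsum f (g x)).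
Proof. by move=> fb; apply: lin_comp; apply: tsum_linear. Qed.

Lemma eq_tsum U V (W : nmodType) (f g : U -> V -> W) (t : tensor U V) :
  (forall u v, f u v = g u v) -> tsum f t = tsum g t.
Proof. by move=> fg; apply: eq_bigr => p _; apply: fg. Qed.

(** Each [tsum] is a finite sum over a representative, so this is the exchange of two finite sums,
    valid for arbitrary [f] as long as neither tensor depends on the other's bound variables. *)
Lemma exchange_tsum U V X Y (W : nmodType) (f : U -> V -> X -> Y -> W) s t :
  \tsum_(u, v <- t) \tsum_(x, y <- s) f u v x y =
  \tsum_(x, y <- s) \tsum_(u, v <- t) f u v x y.
Proof. exact: exchange_big. Qed.

Lemma map_tsum U V X W (h : X -> W) (f : U -> V -> X) t :
  islin h -> h (tsum f t) = \tsum_(u, v <- t) h (f u v).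
Proof. by move=> hl; apply: lin_sum. Qed.

Lemma scale_tsum U V W c (f : U -> V -> W) t :
  c *: tsum f t = \tsum_(u, v <- t) c *: f u v.
Proof. exact: scaler_sumr. Qed.

Lemma tsum_tsum U V X Y W (f : X -> Y -> W) (g : U -> V -> tensor X Y) t :
  is_bilinear f -> tsum f (tsum g t) = \tsum_(u, v <- t) tsum f (g u v).
Proof. by move=> fb; apply: map_tsum; apply: tsum_linear. Qed.

End TsumCalculus.

(* Proves (bi)linearity of a lambda term built from [tsum], [*:] and maps whose
   (bi)linearity is in the context. *)
Ltac lin :=
  cbv beta;
  lazymatch goal with
  | |- is_bilinear _ =>
      tryif first [assumption | exact: pure_bilinear] then idtac
      else (split=> ?; lin)
  | |- islin _ => tryif assumption then idtac else lin_body
  | |- GRing.linear_for _ ?f =>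
      tryif assumption then idtac else (change (islin f); lin_body)
  | |- forall _, _ => intro; lin
  end
with lin_body :=
  lazymatch goal with
  | |- islin (fun w => w) => exact: lin_id
  | |- @islin ?k ?U ?W (fun w => @tsum _ ?X ?Y _ (@?f w) (@?t w)) =>
      lazymatch t with
      | fun _ => ?t0 =>
          refine (@lin_tsumf k X Y U W (fun u v w => f w u v) t0 _);
          intros ? ?; lin
      | _ =>
          lazymatch f with
          | fun _ => ?f0 => refine (@lin_tsumt k X Y U W f0 t _ _); lin
          end
      end
  | |- @islin ?k ?U ?W (fun w => GRing.scale (@?c w) (@?f w)) =>
      lazymatch c with
      | fun _ => ?c0 => refine (@lin_scale k U W c0 f _); lin
      | fun w => ?g (@?h w) =>
          lazymatch f with
          | fun _ => ?v =>
              refine (@lin_scalar k U _ W g h v _ _); [assumption | lin]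
          end
      end
  | |- @islin ?k ?U ?W (fun w => ?op (@?f w) (@?g w)) =>
      lazymatch g with
      | fun _ => ?v =>
          refine (@lin_comp k U _ W (fun x => op x v) f _ _);
          [ refine (proj1 (_ : is_bilinear op) v); lin | lin ]
      | _ =>
          lazymatch f with
          | fun _ => ?u =>
              refine (@lin_comp k U _ W (op u) g _ _);
              [ tryif assumption then idtac
                else (refine (proj2 (_ : is_bilinear op) u); lin) | lin ]
          end
      end
  | |- @islin ?k ?U ?W (fun w => ?g (@?f w)) =>
      refine (@lin_comp k U _ W g f _ _); lin
  | |- islin (?op ?u) =>
      refine (proj2 (_ : is_bilinear op) u); lin
  end.

(** * Sweedler calculus in a single coalgebra *)

Section Coalgebra.
Variables (k : fieldType) (C : lmodType k) (D : C -> tensor C C) (E : C -> k).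
Hypothesis CP : is_coalgebra D E.

Let Dlin : linear D. Proof. exact: comul_linear CP. Qed.

(** A trilinear [f] induces a linear map on the threefold tensor product by lifting twice, first in
    the last two variables and then in the first one; it is applied to both sides of the
    coassociativity axiom. *)
Lemma coassocE (W : lmodType k) (f : C -> C -> C -> W) x :
  (forall y z, linear (fun x => f x y z)) ->
  (forall x z, linear (fun y => f x y z)) ->
  (forall x y, linear (f x y)) ->
  \tsum_(x', x3 <- D x) \tsum_(x1, x2 <- D x') f x1 x2 x3 =
  \tsum_(x1, x'' <- D x) \tsum_(x2, x3 <- D x'') f x1 x2 x3.
Proof.
move=> f1 f2 f3.
have fb x1 : is_bilinear (f x1) by split=> ?; [apply: f2 | apply: f3].
have gb : is_bilinear (fun x1 t => tsum (f x1) t).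
  split=> [t|x1]; last by apply: tsum_linear.
  by apply: lin_tsumf => y z; apply: f1.
have := congr1 (tsum (fun x1 t => tsum (f x1) t)) (coassoc CP x).
rewrite !tsum_tsum //; under eq_tsum => u v.
  rewrite tsum_tsum //; under eq_tsum => y z do rewrite tsum_pure // tsum_pure //.
  over.
by move=> ->; apply: eq_tsum => u v; rewrite tsum_pure.
Qed.

(** This is [f] applied to the counit axiom. Read from right to left it creates a coproduct where
    none is visible, which is how most later collapses are set up. *)
Lemma counitlE (W : lmodType k) (f : C -> W) x :
  linear f -> \tsum_(x1, x2 <- D x) E x1 *: f x2 = f x.
Proof.
move=> fl; rewrite -[in RHS](counitl CP x) map_tsum //.
by apply: eq_tsum => u v; rewrite linZ.
Qed.

Lemma counitrE (W : lmodType k) (f : C -> W) x :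
  linear f -> \tsum_(x1, x2 <- D x) E x2 *: f x1 = f x.
Proof.
move=> fl; rewrite -[in RHS](counitr CP x) map_tsum //.
by apply: eq_tsum => u v; rewrite linZ.
Qed.

Lemma cocommE (W : lmodType k) (f : C -> C -> W) x :
  cocommutative D -> is_bilinear f ->
  tsum f (D x) = \tsum_(x1, x2 <- D x) f x2 x1.
Proof.
move=> Dc fb; rewrite [in LHS]Dc tsum_tsum //.
by apply: eq_tsum => u v; rewrite tsum_pure.
Qed.

End Coalgebra.

(** * The tensor product of two coalgebras *)

Section TensorCoalgebra.
Variables (k : fieldType) (A H : lmodType k).
Variables (DA : A -> tensor A A) (EA : A -> k).
Variables (DH : H -> tensor H H) (EH : H -> k).
Hypotheses (AP : is_coalgebra DA EA) (HP : is_coalgebra DH EH).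

Let DAl : linear DA. Proof. exact: comul_linear AP. Qed.
Let DHl : linear DH. Proof. exact: comul_linear HP. Qed.
Let EAl : scalar EA. Proof. exact: counit_scalar AP. Qed.
Let EHl : scalar EH. Proof. exact: counit_scalar HP. Qed.

Lemma tcomul_linear : linear (tcomul DA DH).
Proof. by rewrite /tcomul; lin. Qed.

Lemma tcomul_pure a x : tcomul DA DH (a \ot x) =
  \tsum_(a1, a2 <- DA a) \tsum_(x1, x2 <- DH x) (a1 \ot x1) \ot (a2 \ot x2).
Proof. by rewrite /tcomul tsum_pure //; lin. Qed.

Lemma tsum_tcomul (W : lmodType k) (f : tensor A H -> tensor A H -> W) a x :
  is_bilinear f ->
  tsum f (tcomul DA DH (a \ot x)) =
  \tsum_(a1, a2 <- DA a) \tsum_(x1, x2 <- DH x) f (a1 \ot x1) (a2 \ot x2).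
Proof.
move=> fb; rewrite /tcomul tsum_pure; last by lin.
rewrite tsum_tsum //; apply: eq_tsum => a1 a2.
rewrite tsum_tsum //; apply: eq_tsum => x1 x2.
by rewrite tsum_pure.
Qed.

(** The sums over [a] and over [x] are independent, so they can be separated, rebracketed by
    [coassocE] in each factor, and interleaved again. The interleaved form is the one produced by
    the actions of a matched pair, where each leg of one element meets the same leg of the other. *)
Lemma coassoc2E (W : lmodType k) (f : A -> H -> A -> H -> A -> H -> W) a x :
  (forall x1 a2 x2 a3 x3, linear (fun a1 => f a1 x1 a2 x2 a3 x3)) ->
  (forall a1 a2 x2 a3 x3, linear (fun x1 => f a1 x1 a2 x2 a3 x3)) ->
  (forall a1 x1 x2 a3 x3, linear (fun a2 => f a1 x1 a2 x2 a3 x3)) ->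
  (forall a1 x1 a2 a3 x3, linear (fun x2 => f a1 x1 a2 x2 a3 x3)) ->
  (forall a1 x1 a2 x2 x3, linear (fun a3 => f a1 x1 a2 x2 a3 x3)) ->
  (forall a1 x1 a2 x2 a3, linear (fun x3 => f a1 x1 a2 x2 a3 x3)) ->
  \tsum_(a', a3 <- DA a) \tsum_(x', x3 <- DH x)
    \tsum_(a1, a2 <- DA a') \tsum_(x1, x2 <- DH x') f a1 x1 a2 x2 a3 x3 =
  \tsum_(a1, a'' <- DA a) \tsum_(x1, x'' <- DH x)
    \tsum_(a2, a3 <- DA a'') \tsum_(x2, x3 <- DH x'') f a1 x1 a2 x2 a3 x3.
Proof.
move=> f1 f2 f3 f4 f5 f6.
transitivity (\tsum_(a', a3 <- DA a) \tsum_(a1, a2 <- DA a')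
   \tsum_(x', x3 <- DH x) \tsum_(x1, x2 <- DH x') f a1 x1 a2 x2 a3 x3).
  by apply: eq_tsum => a' a3; rewrite exchange_tsum.
rewrite (coassocE AP); first last.
- move=> a1 a2; apply: lin_tsumf => u v; apply: lin_tsumf => u' v'; exact: f5.
- move=> a1 a2; apply: lin_tsumf => u v; apply: lin_tsumf => u' v'; exact: f3.
- move=> a1 a2; apply: lin_tsumf => u v; apply: lin_tsumf => u' v'; exact: f1.
apply: eq_tsum => a1 a''; rewrite [RHS]exchange_tsum; apply: eq_tsum => a2 a3.
by rewrite (coassocE HP).
Qed.


Lemma tcounit_scalar : scalar (tcounit EA EH).
Proof.
(* A scalar form is a linear map into [k^o]; writing the product of counits as a scaling gives it a
   shape that [lin] recognizes. *)
by change (@islin k _ k^o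
  (fun t => \tsum_(a, x <- t) EA a *: (EH x : k^o))); lin.
Qed.

Lemma tcounit_pure a x : tcounit EA EH (a \ot x) = EA a * EH x.
Proof.
rewrite /tcounit.
have b : @is_bilinear k A H k^o (fun a x => EA a *: (EH x : k^o)) by lin.
exact: (tsum_pure b).
Qed.

(** By [tensor_ext] each axiom is checked on pure tensors only. Coassociativity is then [coassoc2E],
    and the counit laws follow by contracting one factor at a time. *)
Lemma is_coalgebra_tensor : is_coalgebra (tcomul DA DH) (tcounit EA EH).
Proof.
have Dl := tcomul_linear; have El := tcounit_scalar.
split=> //.
- apply: tensor_ext; [lin | lin |] => a x.
  rewrite !tsum_tcomul; [|lin..].
  under eq_tsum => a1 a2 do under eq_tsum => x1 x2 do
    (rewrite tsum_tcomul; last by lin).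
  rewrite coassoc2E; [|lin..].
  apply: eq_tsum => a1 a2; apply: eq_tsum => x1 x2.
  rewrite /tcomul tsum_pure; last by lin.
  rewrite map_tsum; last by lin.
  apply: eq_tsum => a3 a4; rewrite map_tsum //; lin.
- apply: tensor_ext; [lin | lin |] => a x.
  rewrite tsum_tcomul; last by lin.
  under eq_tsum => a1 a2 do under eq_tsum => x1 x2 do
    rewrite tcounit_pure -scalerA.
  rewrite -[RHS](counitlE AP (f := fun a => a \ot x)); last by lin.
  apply: eq_tsum => a1 a2.
  rewrite -(counitlE HP (f := fun x => a2 \ot x)); last by lin.
  by rewrite scale_tsum.
- apply: tensor_ext; [lin | lin |] => a x.
  rewrite tsum_tcomul; last by lin.
  under eq_tsum => a1 a2 do under eq_tsum => x1 x2 do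
    rewrite tcounit_pure -scalerA.
  rewrite -[RHS](counitrE AP (f := fun a => a \ot x)); last by lin.
  apply: eq_tsum => a1 a2.
  rewrite -(counitrE HP (f := fun x => a1 \ot x)); last by lin.
  by rewrite scale_tsum.
Qed.

End TensorCoalgebra.

(** * Hopf algebra structures on an opposite and on a tensor product *)

Lemma hopf_op (k : fieldType) (C : lmodType k) (m : C -> C -> C) e D E S :
  is_hopf m e D E S -> cocommutative D -> is_hopf (fun x y => m y x) e D E S.
Proof.
move=> CP Dc; case: (CP) => -[mB mA ml mr] cP De Dm Ee Em Sl S1 S2.
have Dl := comul_linear cP.
split=> //.
- by split=> //; lin.
- by move=> x y; rewrite Dm exchange_tsum.
- by move=> x y; rewrite Em mulrC.
(* The reversed product puts [S x1] to the right of [x2]; swapping the legs of the coproduct gives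
   the right antipode law of the original product. The next goal is symmetric. *)
- by move=> x; rewrite (cocommE _ Dc) ?S2 //; lin.
- by move=> x; rewrite (cocommE _ Dc) ?S1 //; lin.
Qed.

(** Two uses of [tensor_ext] with target [k^o], one for each argument. The product [m] is arbitrary
    so that both the componentwise and the bicrossed product are covered. *)
Lemma scalar_mul_tensor (k : fieldType) (A H : lmodType k)
    (m : tensor A H -> tensor A H -> tensor A H) (e : tensor A H -> k) :
  is_bilinear m -> scalar e ->
  (forall a x b y,
    e (m (a \ot x) (b \ot y)) = e (a \ot x) * e (b \ot y)) ->
  forall s t, e (m s t) = e s * e t.
Proof.
move=> mB el em s t.
have ml (f : tensor A H -> tensor A H) :
    linear f -> linear (fun s => e (f s) : k^o).
  by move=> fl a u v; rewrite fl el.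
have mr (c : k) : linear (fun s => e s * c : k^o).
  by move=> a u v; rewrite el mulrDl -mulrA.
have mc (c : k) : linear (fun s => c * e s : k^o).
  by move=> a u v; rewrite el mulrDr mulrCA.
apply: (@tensor_ext k A H k^o (fun s => e (m s t)) (fun s => e s * e t)) => //.
  by apply: (ml (m^~ t)); lin.
move=> a x.
apply: (@tensor_ext k A H k^o (fun t => e (m (a \ot x) t))
  (fun t => e (a \ot x) * e t)) => //.
by apply: (ml (m (a \ot x))); lin.
Qed.

Section TensorHopf.
Variables (k : fieldType) (A H : lmodType k).
Variables (mA : A -> A -> A) (eA : A) (DA : A -> tensor A A) (EA : A -> k)
  (SA : A -> A).
Variables (mH : H -> H -> H) (eH : H) (DH : H -> tensor H H) (EH : H -> k)
  (SH : H -> H).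
Hypotheses (AP : is_hopf mA eA DA EA SA) (HP : is_hopf mH eH DH EH SH).

Definition tensor_mul (s t : tensor A H) : tensor A H :=
  \tsum_(a, x <- s) \tsum_(b, y <- t) mA a b \ot mH x y.

Definition tensor_antipode (t : tensor A H) : tensor A H :=
  \tsum_(a, x <- t) SA a \ot SH x.

(** The products [mA] and [mH] are plain functions, not those of an [algType], so that [mH] can be
    instantiated with a reversed product. *)
Lemma hopf_tensor : is_hopf tensor_mul (eA \ot eH) (tcomul DA DH)
  (tcounit EA EH) tensor_antipode.
Proof.
case: (AP) => -[mAB mAA mAl mAr] cAP DAe DAm EAe EAm SAl SA1 SA2.
case: (HP) => -[mHB mHA mHl mHr] cHP DHe DHm EHe EHm SHl SH1 SH2.
have DAl := comul_linear cAP; have DHl := comul_linear cHP.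
have EAl := counit_scalar cAP; have EHl := counit_scalar cHP.
have tP := is_coalgebra_tensor cAP cHP.
have Dl := comul_linear tP; have El := counit_scalar tP.
have mB : is_bilinear tensor_mul by rewrite /tensor_mul; lin.
have mE a x b y : tensor_mul (a \ot x) (b \ot y) = mA a b \ot mH x y.
  by rewrite /tensor_mul tsum_pure ?tsum_pure //; lin.
have Sl : linear tensor_antipode by rewrite /tensor_antipode; lin.
have SE a x : tensor_antipode (a \ot x) = SA a \ot SH x.
  by rewrite /tensor_antipode tsum_pure //; lin.
have EE := tcounit_pure cAP cHP.
have DE := tcomul_pure cAP cHP.
split=> //.
- split=> //.
  + move=> s t r; move: s; apply: tensor_ext; [lin | lin |] => a x.
    move: t; apply: tensor_ext; [lin | lin |] => b y.
    move: r; apply: tensor_ext; [lin | lin |] => c z.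
    by rewrite !mE mAA mHA.
  + by apply: tensor_ext; [lin | lin |] => a x; rewrite mE mAl mHl.
  + by apply: tensor_ext; [lin | lin |] => a x; rewrite mE mAr mHr.
- rewrite DE DAe tsum_pure; last by lin.
  by rewrite DHe tsum_pure //; lin.
- move=> s t; move: s; apply: tensor_ext; [lin | lin |] => a x.
  move: t; apply: tensor_ext; [lin | lin |] => b y.
  rewrite mE DE DAm DHm tsum_tsum; last by lin.
  rewrite (tsum_tcomul cAP cHP); last by lin.
  apply: eq_tsum => a1 a2; rewrite tsum_tsum; last by lin.
  under [RHS]eq_tsum => x1 x2 do (rewrite (tsum_tcomul cAP cHP); last by lin).
  rewrite [RHS]exchange_tsum; apply: eq_tsum => b1 b2.
  rewrite tsum_pure; last by lin.
  rewrite tsum_tsum; last by lin.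
  apply: eq_tsum => x1 x2; rewrite tsum_tsum; last by lin.
  apply: eq_tsum => y1 y2; rewrite tsum_pure; last by lin.
  by rewrite !mE.
- by rewrite EE EAe EHe mulr1.
- by apply: scalar_mul_tensor => // a x b y; rewrite mE !EE EAm EHm mulrACA.
- apply: tensor_ext; [lin | lin |] => a x.
  rewrite (tsum_tcomul cAP cHP); last by lin.
  (* The antipode law of the second factor is used first, which leaves a sum over the coproduct of
     [a] alone. *)
  transitivity (\tsum_(a1, a2 <- DA a) mA (SA a1) a2 \ot (EH x *: eH)).
    apply: eq_tsum => a1 a2; rewrite -SH1 map_tsum; last by lin.
    by apply: eq_tsum => x1 x2; rewrite SE mE.
  rewrite -(map_tsum (h := fun a => a \ot (EH x *: eH))); last by lin.
  rewrite SA1 EE -scalerA (linZ (g := fun a => a \ot (EH x *: eH))); last by lin.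
  by rewrite linZ //; lin.
- apply: tensor_ext; [lin | lin |] => a x.
  rewrite (tsum_tcomul cAP cHP); last by lin.
  transitivity (\tsum_(a1, a2 <- DA a) mA a1 (SA a2) \ot (EH x *: eH)).
    apply: eq_tsum => a1 a2; rewrite -SH2 map_tsum; last by lin.
    by apply: eq_tsum => x1 x2; rewrite SE mE.
  rewrite -(map_tsum (h := fun a => a \ot (EH x *: eH))); last by lin.
  rewrite SA2 EE -scalerA (linZ (g := fun a => a \ot (EH x *: eH))); last by lin.
  by rewrite linZ //; lin.
Qed.

End TensorHopf.

Lemma exchange2_tsum (k : fieldType) (U1 V1 U2 V2 X1 Y1 X2 Y2 : lmodType k)
    (W : nmodType) (f : U1 -> V1 -> U2 -> V2 -> X1 -> Y1 -> X2 -> Y2 -> W)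
    t1 t2 s1 s2 :
  \tsum_(u1, v1 <- t1) \tsum_(u2, v2 <- t2)
    \tsum_(x1, y1 <- s1) \tsum_(x2, y2 <- s2) f u1 v1 u2 v2 x1 y1 x2 y2 =
  \tsum_(x1, y1 <- s1) \tsum_(x2, y2 <- s2)
    \tsum_(u1, v1 <- t1) \tsum_(u2, v2 <- t2) f u1 v1 u2 v2 x1 y1 x2 y2.
Proof.
under eq_tsum => u1 v1.
  rewrite exchange_tsum; under eq_tsum => x1 y1 do rewrite exchange_tsum.
  over.
rewrite exchange_tsum; apply: eq_tsum => x1 y1.
by rewrite exchange_tsum.
Qed.

(** * The bicrossed product of a matched pair *)

Section Bicrossed.
Variables (k : fieldType) (A H : algType k).
Variables (DA : A -> tensor A A) (EA : A -> k) (SA : A -> A).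
Variables (DH : H -> tensor H H) (EH : H -> k) (SH : H -> H).
Variables (lact : H -> A -> A) (ract : H -> A -> H).
Hypotheses (AP : is_hopf *%R 1 DA EA SA) (HP : is_hopf *%R 1 DH EH SH).
Hypothesis MP : is_matched_pair DA EA DH EH lact ract.

Let mAB : is_bilinear ( *%R : A -> A -> A).
Proof. exact: alg_bilinear (hopf_algebra AP). Qed.
Let mHB : is_bilinear ( *%R : H -> H -> H).
Proof. exact: alg_bilinear (hopf_algebra HP). Qed.
Let cAP : is_coalgebra DA EA. Proof. exact: hopf_coalgebra AP. Qed.
Let cHP : is_coalgebra DH EH. Proof. exact: hopf_coalgebra HP. Qed.
Let DAl : linear DA. Proof. exact: comul_linear cAP. Qed.
Let DHl : linear DH. Proof. exact: comul_linear cHP. Qed.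
Let EAl : scalar EA. Proof. exact: counit_scalar cAP. Qed.
Let EHl : scalar EH. Proof. exact: counit_scalar cHP. Qed.
Let SAl : linear SA. Proof. exact: antipode_linear AP. Qed.
Let SHl : linear SH. Proof. exact: antipode_linear HP. Qed.
Let lB : is_bilinear lact. Proof. exact: lact_bilinear MP. Qed.
Let rB : is_bilinear ract. Proof. exact: ract_bilinear MP. Qed.
Let tP : is_coalgebra (tcomul DA DH) (tcounit EA EH).
Proof. exact: is_coalgebra_tensor. Qed.
Let Dl : linear (tcomul DA DH). Proof. exact: comul_linear tP. Qed.
Let El : scalar (tcounit EA EH). Proof. exact: counit_scalar tP. Qed.

Local Notation mul := (bicrossed_mul DA DH lact ract).

(** * The matched pair axioms in Sweedler form *)

Lemma comul_lact x a : DA (lact x a) =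
  \tsum_(x1, x2 <- DH x) \tsum_(a1, a2 <- DA a) lact x1 a1 \ot lact x2 a2.
Proof.
have := cmap_comul (lact_cmap MP) (x \ot a).
rewrite tsum_pure // (tsum_tcomul cHP cAP); last by lin.
by under eq_tsum => x1 x2 do under eq_tsum => a1 a2 do rewrite !tsum_pure //.
Qed.

Lemma comul_ract x a : DH (ract x a) =
  \tsum_(x1, x2 <- DH x) \tsum_(a1, a2 <- DA a) ract x1 a1 \ot ract x2 a2.
Proof.
have := cmap_comul (ract_cmap MP) (x \ot a).
rewrite tsum_pure // (tsum_tcomul cHP cAP); last by lin.
by under eq_tsum => x1 x2 do under eq_tsum => a1 a2 do rewrite !tsum_pure //.
Qed.

Lemma counit_lact x a : EA (lact x a) = EH x * EA a.
Proof.
have := cmap_counit (lact_cmap MP) (x \ot a).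
by rewrite tsum_pure // (tcounit_pure cHP cAP).
Qed.

Lemma counit_ract x a : EH (ract x a) = EH x * EA a.
Proof.
have := cmap_counit (ract_cmap MP) (x \ot a).
by rewrite tsum_pure // (tcounit_pure cHP cAP).
Qed.

Lemma lact_ractE (W : lmodType k) (f : H -> A -> W) x a : is_bilinear f ->
  \tsum_(x1, x2 <- DH x) \tsum_(a1, a2 <- DA a) f (ract x1 a1) (lact x2 a2) =
  \tsum_(x1, x2 <- DH x) \tsum_(a1, a2 <- DA a) f (ract x2 a2) (lact x1 a1).
Proof.
move=> fB; have := congr1 (tsum f) (lact_ract MP x a).
rewrite !tsum_tsum //.
under eq_tsum => x1 x2.
  rewrite tsum_tsum //; under eq_tsum => a1 a2 do rewrite tsum_pure //.
  over.
move=> ->; apply: eq_tsum => x1 x2.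
by rewrite tsum_tsum //; apply: eq_tsum => a1 a2; rewrite tsum_pure.
Qed.

(** * Unit, associativity and bialgebra laws of the bicrossed product *)

Lemma bicrossed_bilinear : is_bilinear mul.
Proof. by rewrite /bicrossed_mul; lin. Qed.

Let mB := bicrossed_bilinear.

Lemma bicrossed_pure a x b y : mul (a \ot x) (b \ot y) =
  \tsum_(x1, x2 <- DH x) \tsum_(b1, b2 <- DA b)
    (a * lact x1 b1) \ot (ract x2 b2 * y).
Proof. by rewrite /bicrossed_mul tsum_pure ?tsum_pure //; lin. Qed.

(** The unit of [H] is group-like and fixes [b1], while [ract 1 b2] is the counit of [b2] times [1],
    so the coproduct of [b] collapses. Together with [bicrossed_mul_inr] this yields both unit laws
    and the factorization of [a \ot x] as the product of [a \ot 1] and [1 \ot x]. *)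
Lemma bicrossed_mul_inl a b y :
  mul (a \ot 1) (b \ot y) = (a * b) \ot y.
Proof.
rewrite bicrossed_pure (comul_unit HP) tsum_pure; last by lin.
rewrite -[RHS](counitrE cAP (f := fun b => (a * b) \ot y)); last by lin.
apply: eq_tsum => b1 b2; rewrite (lact1 MP) (ract_unit MP) -scalerAl mul1r.
by rewrite linZ //; lin.
Qed.

Lemma bicrossed_mul_inr a x y :
  mul (a \ot x) (1 \ot y) = a \ot (x * y).
Proof.
rewrite bicrossed_pure (comul_unit AP).
rewrite -[RHS](counitlE cHP (f := fun x => a \ot (x * y))); last by lin.
apply: eq_tsum => x1 x2; rewrite tsum_pure; last by lin.
rewrite (lact_unit MP) (ract1 MP) -scalerAr mulr1.
by rewrite (linZ (g := fun a => a \ot (x2 * y))) //; lin.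
Qed.

Lemma comul_mul_lact (W : lmodType k) (f : A -> A -> W) b y c :
  is_bilinear f ->
  tsum f (DA (b * lact y c)) =
  \tsum_(y1, y2 <- DH y) \tsum_(c1, c2 <- DA c) \tsum_(b1, b2 <- DA b)
    f (b1 * lact y1 c1) (b2 * lact y2 c2).
Proof.
move=> fB; rewrite (comul_mul AP) exchange_tsum tsum_tsum // comul_lact.
rewrite tsum_tsum; last by lin.
apply: eq_tsum => y1 y2; rewrite tsum_tsum; last by lin.
apply: eq_tsum => c1 c2; rewrite tsum_pure; last by lin.
by rewrite tsum_tsum //; apply: eq_tsum => b1 b2; rewrite tsum_pure.
Qed.

Lemma comul_ract_mul (W : lmodType k) (f : H -> H -> W) x b y :
  is_bilinear f ->
  tsum f (DH (ract x b * y)) =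
  \tsum_(x1, x2 <- DH x) \tsum_(b1, b2 <- DA b) \tsum_(y1, y2 <- DH y)
    f (ract x1 b1 * y1) (ract x2 b2 * y2).
Proof.
move=> fB; rewrite (comul_mul HP) tsum_tsum // comul_ract.
rewrite tsum_tsum; last by lin.
apply: eq_tsum => x1 x2; rewrite tsum_tsum; last by lin.
apply: eq_tsum => b1 b2; rewrite tsum_pure; last by lin.
by rewrite tsum_tsum //; apply: eq_tsum => y1 y2; rewrite tsum_pure.
Qed.

(** Both bracketings expand to one sum over threefold coproducts of [x], [b], [y] and [c]. The
    actions are expanded by [lact_mul] and [ractM] on the left of the equation, by [lactM] and
    [ract_mul] on the right. *)
Lemma bicrossed_mulA : associative mul.
Proof.
move=> s t r; move: s; apply: tensor_ext; [lin | lin |] => a x.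
move: t; apply: tensor_ext; [lin | lin |] => b y.
move: r; apply: tensor_ext; [lin | lin |] => c z.
rewrite [mul (b \ot y) _]bicrossed_pure [mul (a \ot x) (b \ot y)]bicrossed_pure.
transitivity
  (\tsum_(x1, x'' <- DH x) \tsum_(b1, b'' <- DA b)
   \tsum_(x2, x3 <- DH x'') \tsum_(b2, b3 <- DA b'')
   \tsum_(y1, y'' <- DH y) \tsum_(c1, c'' <- DA c)
   \tsum_(y2, y3 <- DH y'') \tsum_(c2, c3 <- DA c'')
     (a * lact x1 b1 * lact (ract x2 b2) (lact y1 c1)) \ot
     (ract (ract x3 b3) (lact y2 c2) * ract y3 c3 * z)).
  (* Expanding the product of [s] with that of [t] and [r] yields left-nested coproducts, so the
     common form is rebracketed, first in the pair [x], [b] and then in the pair [y], [c]. *)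
  rewrite -(coassoc2E cHP cAP); try lin.
  under [RHS]eq_tsum => x' x3 do under eq_tsum => b' b3 do
    under eq_tsum => x1 x2 do under eq_tsum => b1 b2 do
    (rewrite -(coassoc2E cHP cAP); try lin).
  under [RHS]eq_tsum => x' x3 do under eq_tsum => b' b3 do
    rewrite exchange2_tsum.
  rewrite [RHS]exchange2_tsum (map_tsum (h := mul (a \ot x))); last by lin.
  apply: eq_tsum => y' y3.
  rewrite (map_tsum (h := mul (a \ot x))); last by lin.
  apply: eq_tsum => c' c3.
  rewrite bicrossed_pure; apply: eq_tsum => x' x3.
  rewrite comul_mul_lact; last by lin.
  under [RHS]eq_tsum => b' b3 do rewrite exchange2_tsum.
  under eq_tsum => y1 y2 do rewrite exchange_tsum.
  rewrite exchange_tsum; apply: eq_tsum => b' b3.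
  apply: eq_tsum => y1 y2; apply: eq_tsum => c1 c2.
  rewrite (lact_mul MP) (ractM MP).
  rewrite (map_tsum (h := fun d => (a * d) \ot _)); last by lin.
  apply: eq_tsum => x1 x2.
  rewrite (map_tsum (h := fun d => (a * d) \ot _)); last by lin.
  by apply: eq_tsum => b1 b2; rewrite !mulrA.
(* The other bracketing directly produces the right-nested coproducts of the common form. *)
symmetry.
rewrite (map_tsum (h := mul^~ (c \ot z))); last by lin.
apply: eq_tsum => x1 x''.
rewrite (map_tsum (h := mul^~ (c \ot z))); last by lin.
apply: eq_tsum => b1 b''.
rewrite bicrossed_pure comul_ract_mul; last by lin.
apply: eq_tsum => x2 x3; apply: eq_tsum => b2 b3; apply: eq_tsum => y1 y''.
apply: eq_tsum => c1 c''; rewrite (lactM MP) (ract_mul MP).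
rewrite (map_tsum (h := fun d => _ \ot (d * z))); last by lin.
apply: eq_tsum => y2 y3.
by rewrite (map_tsum (h := fun d => _ \ot (d * z))) //; lin.
Qed.

(** The two sides differ only in the middle legs of the fourfold coproducts of [x] and [b]: the
    coproduct of the product lets legs 1 and 2 enter [lact], the product of the coproducts legs 1
    and 3. The compatibility [lact_ractE] exchanges legs 2 and 3. *)
Lemma bicrossed_comul s t : tcomul DA DH (mul s t) =
  \tsum_(s1, s2 <- tcomul DA DH s) \tsum_(t1, t2 <- tcomul DA DH t)
    mul s1 t1 \ot mul s2 t2.
Proof.
move: s; apply: tensor_ext; [lin | lin |] => a x.
move: t; apply: tensor_ext; [lin | lin |] => b y.
rewrite (tsum_tcomul cAP cHP); last by lin.
under [RHS]eq_tsum => a1 a2 do under eq_tsum => x1 x2 do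
  (rewrite (tsum_tcomul cAP cHP); last by lin).
transitivity
  (\tsum_(a1, a2 <- DA a) \tsum_(y1, y2 <- DH y)
   \tsum_(x', x'' <- DH x) \tsum_(b', b'' <- DA b)
   \tsum_(x1, x2 <- DH x') \tsum_(b1, b2 <- DA b')
   \tsum_(x3, x4 <- DH x'') \tsum_(b3, b4 <- DA b'')
     ((a1 * lact x1 b1) \ot (ract x3 b3 * y1)) \ot
     ((a2 * lact x2 b2) \ot (ract x4 b4 * y2))).
  rewrite exchange2_tsum.
  under [RHS]eq_tsum => x' x'' do under eq_tsum => b' b'' do
    rewrite exchange2_tsum.
  rewrite bicrossed_pure (map_tsum (h := tcomul DA DH)) //.
  apply: eq_tsum => x' x''; rewrite (map_tsum (h := tcomul DA DH)) //.
  apply: eq_tsum => b' b''; rewrite (tcomul_pure cAP cHP) comul_mul_lact; last by lin.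
  apply: eq_tsum => x1 x2; apply: eq_tsum => b1 b2; apply: eq_tsum => a1 a2.
  rewrite comul_ract_mul; last by lin.
  rewrite [RHS]exchange_tsum; apply: eq_tsum => x3 x4.
  by rewrite [RHS]exchange_tsum.
transitivity
  (\tsum_(a1, a2 <- DA a) \tsum_(y1, y2 <- DH y)
   \tsum_(x', x'' <- DH x) \tsum_(b', b'' <- DA b)
   \tsum_(x1, x2 <- DH x') \tsum_(b1, b2 <- DA b')
   \tsum_(x3, x4 <- DH x'') \tsum_(b3, b4 <- DA b'')
     ((a1 * lact x1 b1) \ot (ract x2 b2 * y1)) \ot
     ((a2 * lact x3 b3) \ot (ract x4 b4 * y2))).
  apply: eq_tsum => a1 a2; apply: eq_tsum => y1 y2.
  (* The legs pass from the bracketing [(1 2) (3 4)] to [1 ((2 3) 4)], so that legs 2 and 3 come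
     from a single coproduct. *)
  rewrite [LHS](coassoc2E cHP cAP); try lin.
  rewrite [RHS](coassoc2E cHP cAP); try lin.
  apply: eq_tsum => x1 x''; apply: eq_tsum => b1 b''.
  rewrite -[LHS](coassoc2E cHP cAP); try lin.
  rewrite -[RHS](coassoc2E cHP cAP); try lin.
  apply: eq_tsum => x' x4; apply: eq_tsum => b' b4.
  by rewrite (lact_ractE (f := fun u v => ((a1 * lact x1 b1) \ot (u * y1)) \ot
     ((a2 * v) \ot (ract x4 b4 * y2)))) //; lin.
apply: eq_tsum => a1 a2; rewrite exchange_tsum; apply: eq_tsum => x' x''.
rewrite exchange_tsum; apply: eq_tsum => b' b''; apply: eq_tsum => y1 y2.
rewrite !bicrossed_pure (map_tsum (h := fun s => s \ot _)); last by lin.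
apply: eq_tsum => x1 x2.
rewrite (map_tsum (h := fun s => s \ot _)); last by lin.
apply: eq_tsum => b1 b2; rewrite map_tsum; last by lin.
by apply: eq_tsum => x3 x4; rewrite map_tsum //; lin.
Qed.

Lemma bicrossed_counit s t :
  tcounit EA EH (mul s t) = tcounit EA EH s * tcounit EA EH t.
Proof.
apply: scalar_mul_tensor => // a x b y.
rewrite bicrossed_pure (map_tsum (W := k^o)) //.
(* The counits of the legs of [b] are contracted first; what remains has the shape of the counit law
   for [x]. *)
transitivity (\tsum_(x1, x2 <- DH x) EH x1 *:
  ((EH x2 : k^o) * (EA a * EA b * EH y))).
  apply: eq_tsum => x1 x2; rewrite (map_tsum (W := k^o)) //.
  have bl : linear (fun b => (EA a * EH x1 * EH x2 * EH y) *: (EA b : k^o)).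
    by lin.
  rewrite [RHS](_ : _ = (EA a * EH x1 * EH x2 * EH y) *: (EA b : k^o)).
    rewrite -(counitlE cAP _ bl); apply: eq_tsum => b1 b2.
    rewrite (tcounit_pure cAP cHP) (counit_mul AP) (counit_mul HP).
    rewrite counit_lact counit_ract /GRing.scale /=.
    ring.
  rewrite /GRing.scale /=; ring.
have xl : linear (fun x => (EA a * EA b * EH y) *: (EH x : k^o)) by lin.
rewrite (tcounit_pure cAP cHP) (tcounit_pure cAP cHP).
transitivity ((EA a * EA b * EH y) *: (EH x : k^o)).
  rewrite -(counitlE cHP _ xl); apply: eq_tsum => x1 x2.
  by rewrite [X in _ *: X]mulrC.
by rewrite /GRing.scale /=; ring.
Qed.

(** * The antipode of the bicrossed product *)

Definition bicrossed_antipode (t : tensor A H) : tensor A H :=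
  \tsum_(a, x <- t) mul (1 \ot SH x) (SA a \ot 1).

Lemma bicrossed_antipode_linear : linear bicrossed_antipode.
Proof. by rewrite /bicrossed_antipode; lin. Qed.

Let bSl := bicrossed_antipode_linear.

Lemma bicrossed_antipode_pure a x :
  bicrossed_antipode (a \ot x) = mul (1 \ot SH x) (SA a \ot 1).
Proof. by rewrite /bicrossed_antipode tsum_pure //; lin. Qed.

Lemma bicrossed_hopf : is_hopf mul (1 \ot 1) (tcomul DA DH) (tcounit EA EH)
  bicrossed_antipode.
Proof.
split=> //.
- split=> //.
  + exact: bicrossed_mulA.
  + by apply: tensor_ext; [lin | lin |] => a x; rewrite bicrossed_mul_inl mul1r.
  + by apply: tensor_ext; [lin | lin |] => a x; rewrite bicrossed_mul_inr mulr1.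
- rewrite (tcomul_pure cAP cHP) (comul_unit AP) tsum_pure; last by lin.
  by rewrite (comul_unit HP) tsum_pure //; lin.
- exact: bicrossed_comul.
- by rewrite (tcounit_pure cAP cHP) (counit_unit AP) (counit_unit HP) mulr1.
- exact: bicrossed_counit.
- apply: tensor_ext; [lin | lin |] => a x.
  rewrite (tsum_tcomul cAP cHP); last by lin.
  (* In this law the [A] factors [SA a1] and [a2] are adjacent and cancel first, so the sum over [a]
     has to be the inner one. *)
  rewrite exchange_tsum.
  transitivity (\tsum_(x1, x2 <- DH x) EA a *: ((1 : A) \ot (SH x1 * x2))).
    apply: eq_tsum => x1 x2.
    transitivity (\tsum_(a1, a2 <- DA a)
        mul (1 \ot SH x1) ((SA a1 * a2) \ot x2)).
      apply: eq_tsum => a1 a2.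
      by rewrite bicrossed_antipode_pure -bicrossed_mulA bicrossed_mul_inl.
    rewrite -(map_tsum (h := fun d => mul (1 \ot SH x1) (d \ot x2)));
      last by lin.
    rewrite (antipodel AP).
    rewrite (linZ (g := fun d => mul (1 \ot SH x1) (d \ot x2))); last by lin.
    by rewrite bicrossed_mul_inr.
  rewrite -(map_tsum (h := fun d => EA a *: ((1 : A) \ot d))); last by lin.
  rewrite (antipodel HP) (linZ (g := fun d => EA a *: ((1 : A) \ot d))); last by lin.
  by rewrite (tcounit_pure cAP cHP) scalerA mulrC.
- apply: tensor_ext; [lin | lin |] => a x.
  rewrite (tsum_tcomul cAP cHP); last by lin.
  (* Here the [H] factors [x1] and [SH x2] are adjacent instead, and the sum over [x] is contracted
     first. *)
  transitivity (\tsum_(a1, a2 <- DA a) EH x *: ((a1 * SA a2) \ot (1 : H))).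
    apply: eq_tsum => a1 a2.
    transitivity (\tsum_(x1, x2 <- DH x)
        mul (a1 \ot (x1 * SH x2)) (SA a2 \ot 1)).
      apply: eq_tsum => x1 x2.
      by rewrite bicrossed_antipode_pure bicrossed_mulA bicrossed_mul_inr.
    rewrite -(map_tsum (h := fun d => mul (a1 \ot d) (SA a2 \ot 1)));
      last by lin.
    rewrite (antipoder HP).
    rewrite (linZ (g := fun d => mul (a1 \ot d) (SA a2 \ot 1))); last by lin.
    by rewrite bicrossed_mul_inl.
  rewrite -(map_tsum (h := fun d => EH x *: (d \ot (1 : H)))); last by lin.
  rewrite (antipoder AP) (linZ (g := fun d => EH x *: (d \ot (1 : H)))); last by lin.
  by rewrite (tcounit_pure cAP cHP) scalerA.
Qed.

(** * Brace compatibility, for a circle product known by its values on pure tensors *)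

Lemma bicrossed_brace_compat (circ : tensor A H -> tensor A H -> tensor A H)
    s t r :
  is_bilinear circ ->
  (forall a x b y, circ (a \ot x) (b \ot y) = (a * b) \ot (y * x)) ->
  circ s (mul t r) =
  \tsum_(s', s3 <- tcomul DA DH s) \tsum_(s1, s2 <- tcomul DA DH s')
    mul (mul (circ s1 t) (bicrossed_antipode s2)) (circ s3 r).
Proof.
move=> cB cE.
move: s; apply: tensor_ext; [lin | lin |] => a h.
move: t; apply: tensor_ext; [lin | lin |] => b y.
move: r; apply: tensor_ext; [lin | lin |] => c z.
rewrite (tsum_tcomul cAP cHP); last by lin.
(* Circle multiplication by [a \ot h] acts by [a] on the far left and by [h] on the far right, so it
   does not interfere with the actions inside the bicrossed product. *)
transitivity (mul ((a * b) \ot y) (c \ot (z * h))).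
  rewrite !bicrossed_pure (map_tsum (h := circ (a \ot h))); last by lin.
  apply: eq_tsum => y1 y2.
  rewrite (map_tsum (h := circ (a \ot h))); last by lin.
  by apply: eq_tsum => c1 c2; rewrite cE !mulrA.
transitivity (\tsum_(a', a3 <- DA a) \tsum_(a1, a2 <- DA a')
    mul (mul ((a1 * b) \ot y) (SA a2 \ot 1)) ((a3 * c) \ot (z * h))).
  rewrite (coassocE cAP); try lin.
  (* The inserted counit of [a''] is the value of the contraction of [SA a2] with [a3]. *)
  rewrite -(counitrE cAP (f := fun a => mul ((a * b) \ot y) (c \ot (z * h))));
    last by lin.
  apply: eq_tsum => a1 a''.
  transitivity (\tsum_(a2, a3 <- DA a'')
      mul ((a1 * b) \ot y) ((SA a2 * a3 * c) \ot (z * h))).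
    rewrite -(map_tsum
      (h := fun d => mul ((a1 * b) \ot y) ((d * c) \ot (z * h))));
      last by lin.
    rewrite (antipodel AP) (linZ
      (g := fun d => mul ((a1 * b) \ot y) ((d * c) \ot (z * h))));
      last by lin.
    by rewrite mul1r.
  apply: eq_tsum => a2 a3.
  by rewrite -bicrossed_mulA bicrossed_mul_inl mulrA.
apply: eq_tsum => a' a3.
(* The counit of [h'] is inserted beside [h3], to be expanded as [h1 * SH h2] right after [y]. *)
transitivity (\tsum_(h', h3 <- DH h) EH h' *:
    (\tsum_(a1, a2 <- DA a')
      mul (mul ((a1 * b) \ot y) (SA a2 \ot 1)) ((a3 * c) \ot (z * h3)))).
  by rewrite (counitlE cHP) //; lin.
apply: eq_tsum => h' h3; rewrite (tsum_tcomul cAP cHP); last by lin.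
rewrite scale_tsum; apply: eq_tsum => a1 a2.
transitivity (\tsum_(h1, h2 <- DH h')
    mul (mul ((a1 * b) \ot (y * (h1 * SH h2))) (SA a2 \ot 1))
      ((a3 * c) \ot (z * h3))).
  rewrite -(map_tsum (h := fun d => mul (mul ((a1 * b) \ot (y * d))
    (SA a2 \ot 1)) ((a3 * c) \ot (z * h3)))); last by lin.
  rewrite (antipoder HP) (linZ (g := fun d => mul (mul ((a1 * b) \ot (y * d))
    (SA a2 \ot 1)) ((a3 * c) \ot (z * h3)))); last by lin.
  by rewrite mulr1.
apply: eq_tsum => h1 h2.
by rewrite !cE bicrossed_antipode_pure bicrossed_mulA bicrossed_mul_inr mulrA.
Qed.

End Bicrossed.

(** * The circle product and the assembly of the Hopf brace *)

Section TensorOpMul.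
Variables (k : fieldType) (A H : algType k).

Let mAB : is_bilinear ( *%R : A -> A -> A).
Proof.
by split=> [v a u w|u a v w]; rewrite ?mulrDl ?mulrDr -?scalerAl -?scalerAr.
Qed.

Let mHB : is_bilinear ( *%R : H -> H -> H).
Proof.
by split=> [v a u w|u a v w]; rewrite ?mulrDl ?mulrDr -?scalerAl -?scalerAr.
Qed.

Lemma tensor_op_mul_bilinear : is_bilinear (@tensor_op_mul k A H).
Proof. by rewrite /tensor_op_mul; lin. Qed.

Lemma tensor_op_mul_pure (a b : A) (x y : H) :
  tensor_op_mul (a \ot x) (b \ot y) = (a * b) \ot (y * x).
Proof. by rewrite /tensor_op_mul tsum_pure ?tsum_pure //; lin. Qed.

End TensorOpMul.

Theorem corollary2p6 (k : fieldType) (A H : algType k)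
    (DA : A -> tensor A A) (EA : A -> k) (SA : A -> A)
    (DH : H -> tensor H H) (EH : H -> k) (SH : H -> H)
    (lact : H -> A -> A) (ract : H -> A -> H)
    (hopfA : is_hopf *%R 1 DA EA SA)
    (hopfH : is_hopf *%R 1 DH EH SH)
    (matched : is_matched_pair DA EA DH EH lact ract)
    (cocommH : cocommutative DH) :
  is_hopf_brace (tcomul DA DH) (tcounit EA EH)
    (bicrossed_mul DA DH lact ract) (1 \ot 1)
    (@tensor_op_mul k A H) (1 \ot 1).
Proof.
exists (bicrossed_antipode DA SA DH SH lact ract), (tensor_antipode SA SH).
split.
- exact: bicrossed_hopf.
(* With the reversed product on [H], [tensor_mul] is convertible to [tensor_op_mul]. *)
- exact: hopf_tensor hopfA (hopf_op hopfH cocommH).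
- move=> s t r; apply: (bicrossed_brace_compat hopfA hopfH matched).
    exact: tensor_op_mul_bilinear.
  by move=> a x b y; apply: tensor_op_mul_pure.
Qed.
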